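(* Let $(\Gamma,f,\mu)$ be a measured Reeb graph. (i) The graph $\Gamma$ admits a circulation function if and only if $\int_\Gamma f\,d\mu=0$. (ii) If $\Gamma$ admits a circulation function, then the set of circulation functions on $\Gamma$ is an affine space of dimension equal to the first Betti number of $\Gamma$.
   Context: A measured Reeb graph $(\Gamma,f,\mu)$ is a finite oriented connected graph $\Gamma$ (multiple edges allowed) with a continuous function $f\colon\Gamma\to\mathbb{R}$ and a measure $\mu$ such that: (1) all vertices are 1-valent or 3-valent; (2) at each 3-valent vertex there are either two incoming and one outgoing edges, or two outgoing and one incoming; the single edge is called the trunk $e_0$ of the vertex, the two others its branches $e_1,e_2$; (3) $f$ is strictly monotone on each edge and edges are oriented towards increasing $f$; (4) $\mu$ satisfies the following, where smooth means $C^\infty$ and $[v,x]$ is the part of an edge between its endpoint $v$ and its point $x$: (4a) for every edge $[v,w]$ with $f(v)<f(w)$ there is a function $\eta$, smooth on $(f(v),f(w))$, with $\mu([v,x])=\eta(f(x))$ for all $x\in(v,w)$ and $\eta'(z)\neq0$ for all $z\in(f(v),f(w))$; (4b) if in addition $v$ is 1-valent, $\eta$ is smooth up to $f(v)$ and $\eta'(f(v))\ne0$; analogously, if $w$ is 1-valent, $\eta$ is smooth up to $f(w)$ and $\eta'(f(w))\neq0$; (4c) if $v$ is 3-valent with trunk $e_0$ and branches $e_1,e_2$, then, after replacing $f$ (in this condition only) by $f-f(v)$ so that $f(v)=0$, there exist functions $\psi,\eta_0,\eta_1,\eta_2$ of one variable, smooth near $0\in\mathbb{R}$, such that for every $x\in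 e_i$ sufficiently close to $v$ one has $\mu([v,x])=\varepsilon_i\,\psi(f(x))\ln|f(x)|+\eta_i(f(x))$, where $\varepsilon_0=2$, $\varepsilon_1=\varepsilon_2=-1$, $\psi(0)=0$, $\psi'(0)\ne0$, and $\eta_0+\eta_1+\eta_2=0$. Circulation function on $(\Gamma,f,\mu)$, with vertex set $V(\Gamma)$: a function $\mathcal{C}\colon\Gamma\setminus V(\Gamma)\to\mathbb{R}$ such that (1) for interior points $x,y$ of the same edge, $\mathcal{C}(y)-\mathcal{C}(x)=\int_x^y f\,d\mu$ (for $f(x)<f(y)$ the integral is over the segment of the edge between $x$ and $y$; it changes sign when $x,y$ are interchanged); (2) $\lim_{x\to v}\mathcal{C}(x)=0$ at every 1-valent vertex $v$; (3) at every 3-valent vertex $v$ with trunk $e_0$ and branches $e_1,e_2$, $\lim_{x_0\to v}\mathcal{C}(x_0)=\lim_{x_1\to v}\mathcal{C}(x_1)+\lim_{x_2\to v}\mathcal{C}(x_2)$, where $x_i\in e_i$.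
   Formalization: The measure μ is additionally required to have no atom at any 1-valent vertex; conditions (4a)–(4b) taken literally allow such atoms, and then (i) fails (one edge, f from -1 to 1, Lebesgue measure plus an atom at f = -1). *)

(* Defs.v *)
From HB Require Import structures.
From mathcomp Require Import all_boot all_order all_algebra.
From mathcomp Require Import all_classical all_reals all_analysis.

Set Implicit Arguments.
Unset Strict Implicit.
Unset Printing Implicit Defensive.

Import Order.TTheory GRing.Theory Num.Theory numFieldNormedType.Exports.

Local Open Scope ring_scope.
Local Open Scope classical_set_scope.

(* [basepoint] records that the graph is non-empty; it is kept as data only
   because measurable types have to be pointed. *)
Record multigraph := Multigraph {
  vertex : finType;
  edge : finType;
  src : edge -> vertex;
  tgt : edge -> vertex;
  basepoint : vertex }.

Section Combinatorics.
Variable G : multigraph.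
Implicit Types (v w : vertex G) (e : edge G) (b : bool).

Definition indegree v : nat := #|[set e | tgt e == v]%SET|.
Definition outdegree v : nat := #|[set e | src e == v]%SET|.
Definition valence v : nat := (indegree v + outdegree v)%N.

Definition adjacent : rel (vertex G) := fun v w =>
  [exists e, ((src e == v) && (tgt e == w)) || ((src e == w) && (tgt e == v))].

Definition connected_graph : Prop := forall v w, connect adjacent v w.

Definition edge_end b e : vertex G := if b then tgt e else src e.

(* [v] is 3-valent with trunk [e0] and branches [e1], [e2]: if b = true the
   trunk is incoming and both branches are outgoing, if b = false the trunk is
   outgoing and both branches are incoming. *)
Definition tripod v b (e0 e1 e2 : edge G) : Prop :=
  [/\ valence v = 3%N, edge_end b e0 = v, edge_end (~~ b) e1 = v,
      edge_end (~~ b) e2 = v & e1 <> e2].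

End Combinatorics.

(* First Betti number: the real dimension of H_1 = ker(boundary), a graph
   having no 2-cells. *)
Section Betti.
Variables (R : realType) (G : multigraph).

Definition boundary (c : {ffun edge G -> R^o}) : {ffun vertex G -> R^o} :=
  [ffun v => \sum_(e | tgt e == v) c e - \sum_(e | src e == v) c e].

Fact boundary_linear : linear boundary.
Proof.
move=> a c d; apply/ffunP => v; rewrite !ffunE.
under eq_bigr do rewrite !ffunE.
under [X in _ - X]eq_bigr do rewrite !ffunE.
by rewrite !big_split /= -!scaler_sumr scalerBr opprD addrACA.
Qed.

HB.instance Definition _ := GRing.isLinear.Build R
  {ffun edge G -> R^o} {ffun vertex G -> R^o} _ boundary boundary_linear.

Definition betti1 : nat := \dim (lker (linfun boundary)).

End Betti.

(* Geometric realization. The extended real line, which is homeomorphic to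
   [0, 1], is the model of a closed edge: [inr (e, t)], t real, is an interior
   point of the edge e, whose source (resp. target) sits at t = -oo
   (resp. +oo). *)
Definition realization (R : realType) (G : multigraph) : Type :=
  (vertex G + edge G * R)%type.

HB.instance Definition _ (R : realType) (G : multigraph) :=
  Choice.copy (realization R G) (vertex G + edge G * R)%type.

HB.instance Definition _ (R : realType) (G : multigraph) :=
  isPointed.Build (realization R G) (inl (basepoint G)).

Section Realization.
Variables (R : realType) (G : multigraph).

Definition vertex_pt (v : vertex G) : realization R G := inl v.

Definition edge_path (e : edge G) (t : \bar R) : realization R G :=
  match t with
  | r%:E => inr (e, r)
  | +oo%E => vertex_pt (tgt e)
  | -oo%E => vertex_pt (src e)
  end.

(* The quotient topology, i.e. the final topology for the edge paths. *)
Definition realization_open : set (set (realization R G)) :=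
  [set U | forall e, open (edge_path e @^-1` U)].

Fact realization_openT : realization_open setT.
Proof. by move=> e; rewrite preimage_setT; exact: openT. Qed.

Fact realization_openI : setI_closed realization_open.
Proof. by move=> A B oA oB e; rewrite preimage_setI; exact: openI. Qed.

Fact realization_open_bigU (I : Type) (U : I -> set (realization R G)) :
  (forall i, realization_open (U i)) -> realization_open (\bigcup_i U i).
Proof.
by move=> oU e; rewrite preimage_bigcup; apply: bigcup_open => i _; exact: oU.
Qed.

HB.instance Definition _ := isOpenTopological.Build (realization R G)
  realization_openT realization_openI realization_open_bigU.

Definition borel_realization :=
  g_sigma_algebraType (@open (realization R G)).

Definition segment (e : edge G) (s t : \bar R) : set (realization R G) :=
  edge_path e @` [set u | (s <= u <= t)%E].

(* [v, x] for v = edge_end b e and x = edge_path e t *)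
Definition end_segment (b : bool) (e : edge G) (t : R)
    : set (realization R G) :=
  if b then segment e t%:E +oo else segment e -oo t%:E.

(* Interior points of an edge e tending to edge_end b e. *)
Definition to_end (b : bool) : set_system R :=
  if b then +oo else -oo.

End Realization.

Section Smooth.
Variable R : realType.

(* For open D; derivatives of order 0 and up are all required to exist. *)
Definition smooth_on (D : set R) (g : R -> R) : Prop :=
  forall n z, D z -> derivable g^`(n) z 1.

Definition smooth_near (z : R) (g : R -> R) : Prop :=
  exists2 D, nbhs z D & open D /\ smooth_on D g.

End Smooth.

Section MeasureAxioms.
Variables (R : realType) (G : multigraph).
Variables (f : realization R G -> R)
  (mu : {measure set (borel_realization R G) -> \bar R}).

(* Conditions on mu along the edge e = [v, w]. A function is smooth up to a
   boundary point when it extends smoothly to a neighbourhood of that point;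
   as eta is a total function on R it may be taken to be its own extension. *)
Definition smooth_along (e : edge G) : Prop :=
  let v := src e in let w := tgt e in
  let fv := f (vertex_pt R v) in let fw := f (vertex_pt R w) in
  exists eta : R -> R,
    [/\ smooth_on [set z | fv < z < fw] eta,
        forall t : R, mu (end_segment false e t) =
          (eta (f (edge_path e t%:E)))%:E,
        forall z, fv < z < fw -> eta^`() z != 0,
        valence v = 1%N -> smooth_near fv eta /\ eta^`() fv != 0 &
        valence w = 1%N -> smooth_near fw eta /\ eta^`() fw != 0].

Definition log_expansion (b : bool) (e : edge G) (eps : R) (psi eta : R -> R)
    : Prop :=
  \forall t \near to_end b,
    let z := f (edge_path e t%:E) - f (vertex_pt R (edge_end b e)) in
    mu (end_segment b e t) = (eps * psi z * ln `|z| + eta z)%:E.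

Definition log_smooth_at (b : bool) (e0 e1 e2 : edge G) : Prop :=
  exists psi eta0 eta1 eta2 : R -> R,
    [/\ [/\ smooth_near 0 psi, smooth_near 0 eta0, smooth_near 0 eta1
          & smooth_near 0 eta2],
        [/\ log_expansion b e0 2 psi eta0,
            log_expansion (~~ b) e1 (-1) psi eta1
          & log_expansion (~~ b) e2 (-1) psi eta2],
        psi 0 = 0, psi^`() 0 != 0
      & \forall z \near 0, eta0 z + eta1 z + eta2 z = 0].

End MeasureAxioms.

Record measured_reeb_graph (R : realType) := MeasuredReebGraph {
  graph :> multigraph;
  height : realization R graph -> R;
  mass : {measure set (borel_realization R graph) -> \bar R};
  graph_connected : connected_graph graph;
  height_continuous : continuous height;
  valenceP : forall v : vertex graph, valence v = 1%N \/ valence v = 3%N;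
  trivalentP : forall v : vertex graph, valence v = 3%N ->
    (indegree v = 2%N /\ outdegree v = 1%N) \/
    (indegree v = 1%N /\ outdegree v = 2%N);
  height_increasing : forall (e : edge graph) (s t : \bar R), (s < t)%E ->
    height (edge_path e s) < height (edge_path e t);
  mass_edge : forall e : edge graph, smooth_along height mass e;
  (* The measure of [v, x] determines mass only up to an atom at a 1-valent
     vertex; smoothness up to v is understood to exclude it: [v, v] is null.
     At 3-valent vertices this follows from the last condition, all eta_i(0)
     being equal to the mass of v. *)
  mass_univalent : forall v : vertex graph, valence v = 1%N ->
    mass [set vertex_pt R v] = 0%E;
  mass_trivalent : forall (v : vertex graph) b e0 e1 e2,
    tripod v b e0 e1 e2 -> log_smooth_at height mass b e0 e1 e2 }.

Section Circulation.
Variables (R : realType) (G : measured_reeb_graph R).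

Definition edge_integral (e : edge G) (s t : R) : \bar R :=
  if height (edge_path e s%:E) <= height (edge_path e t%:E)
  then (\int[mass G]_(p in segment e s%:E t%:E) (height p)%:E)%E
  else (- \int[mass G]_(p in segment e t%:E s%:E) (height p)%:E)%E.

(* Functions on the complement of the vertex set, by means of the coordinates
   (e, t) of interior points of edges. *)
Definition interior_fun := (edge G * R)%type -> R^o.

Definition circulation_function (C : interior_fun) : Prop :=
  [/\ forall e s t, (C (e, t) - C (e, s))%:E = edge_integral e s t,
      forall v b e, valence v = 1%N -> edge_end b e = v ->
        C (e, t) @[t --> to_end b] --> (0 : R) &
      forall v b e0 e1 e2, tripod v b e0 e1 e2 ->
        exists l0 l1 l2 : R,
          [/\ C (e0, t) @[t --> to_end b] --> l0,
              C (e1, t) @[t --> to_end (~~ b)] --> l1,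
              C (e2, t) @[t --> to_end (~~ b)] --> l2
            & l0 = l1 + l2]].

End Circulation.

Definition affine_space_of_dim (K : fieldType) (V : lmodType K) (n : nat)
    (S : set V) : Prop :=
  exists (p : V) (u : 'I_n -> V),
    (forall a : 'I_n -> K, \sum_i a i *: u i = 0 -> forall i, a i = 0) /\
    S = [set p + \sum_i a i *: u i | a in [set: 'I_n -> K]].

(* Main.v *)
Require Import Defs.
From HB Require Import structures.
From mathcomp Require Import all_boot all_order all_algebra.
From mathcomp Require Import all_classical all_reals all_analysis.
From mathcomp Require Import zify ring lra.

Set Implicit Arguments.
Unset Strict Implicit.
Unset Printing Implicit Defensive.

Import Order.TTheory GRing.Theory Num.Theory numFieldNormedType.Exports.

Local Open Scope ring_scope.
Local Open Scope classical_set_scope.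

(** The defining integral condition leaves a circulation function only one free
    constant per edge: it forces C(e, x) = c(e) + int_[v,x] f dmu, where v is
    the source of e.  Points carry no mass and mu is finite, so the limit of C
    is c(e) at the source of e and c(e) + I(e) at its target, where I(e) is the
    integral of f over e ([circulation_of_cvg]).  The conditions at 1-valent
    and 3-valent vertices are then one and the same conservation law: the sum
    of the incoming limits equals the sum of the outgoing ones
    ([circulation_of_balanced]).  Written out, it is the linear system

      boundary c = demand,   demand(v) = - sum of I(e) over e ending at v,

    so circulation functions correspond to the solutions c ([circulationP]).

    For part (i), the image of the boundary map of a connected graph consists
    of the vertex functions of total 0: each boundary has total 0
    ([sum_boundary]), and conversely a path from v to w gives a chain with
    boundary w - v, and such differences span ([boundary_onto]).  The total of
    the demand is - int_Gamma f dmu ([sum_demand]), since edges overlap in null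
    sets only.  For part (ii), the solutions form a translate of the kernel of
    the boundary map, whose dimension is the first Betti number by definition.

    The analytic work is in showing that mu is finite and has no atoms.  At a
    3-valent vertex v, psi(z) ln|z| tends to 0 because psi is differentiable
    and vanishes at 0; hence mu [v, x] tends both to eta_i(0) and to mu {v}
    ([expansion_cvg], [end_mass_cvg_vertex]), and the relation
    eta_0 + eta_1 + eta_2 = 0 gives 3 mu {v} = 0 ([mass_vertex]).  Inside an
    edge, atoms are excluded by the continuity of eta ([mass_interior]).  An
    edge has finite mass by the logarithmic expansion at a 3-valent target, and
    by smoothness of eta up to a 1-valent one ([mass_edge_fin]). *)

(** * The boundary map of a connected graph *)

Section Balance.
Variables (R : realType) (G : multigraph).
Implicit Types (v w : vertex G) (e : edge G) (b : bool) (x : edge G -> R).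

Definition star b v : {set edge G} := [set e | edge_end b e == v]%SET.

Lemma mem_star b v e : (e \in star b v) = (edge_end b e == v).
Proof. by rewrite inE. Qed.

Lemma boundaryE (c : {ffun edge G -> R^o}) v :
  boundary c v = \sum_(e in star true v) c e - \sum_(e in star false v) c e.
Proof. by rewrite ffunE; congr (_ - _); apply: eq_bigl => e; rewrite inE. Qed.

Lemma sum_over_stars b x : \sum_v \sum_(e in star b v) x e = \sum_e x e.
Proof.
rewrite [RHS](partition_big (edge_end b) xpredT)//=.
by apply: eq_bigr => v _; apply: eq_bigl => e; rewrite inE.
Qed.

(** Each edge contributes with opposite signs at its two ends. *)
Lemma sum_boundary (c : {ffun edge G -> R^o}) : \sum_v boundary c v = 0.
Proof.
by under eq_bigr do rewrite boundaryE; rewrite sumrB !sum_over_stars subrr.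
Qed.

Definition point_mass v : {ffun vertex G -> R^o} := [ffun u => (u == v)%:R].

Lemma boundary_edge e :
  boundary (R := R) [ffun e' => (e' == e)%:R]
    = point_mass (tgt e) - point_mass (src e).
Proof.
apply/ffunP => v; rewrite !ffunE.
suff delta (p : edge G -> vertex G) :
    \sum_(e' | p e' == v) [ffun e'' => (e'' == e)%:R] e' = (v == p e)%:R :> R^o.
  by rewrite !delta.
have [->|ne] := eqVneq v (p e).
  rewrite (bigD1 e)//= ffunE eqxx big1 ?addr0// => e' /andP[_ /negbTE ne].
  by rewrite ffunE ne.
rewrite big1// => e' /eqP pe'; rewrite ffunE; case: eqP => // ee.
by rewrite -pe' ee eqxx in ne.
Qed.

(** The edges of the path, with sign -1 on those traversed backwards, have a
    telescoping boundary. *)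
Lemma boundary_path v w : connect (@Defs.adjacent G) v w ->
  exists c, boundary (R := R) c = point_mass w - point_mass v.
Proof.
move=> /connectP[p + ->]; elim: p v => [v _|u p IH v /=].
  by exists 0; rewrite linear0 subrr.
move=> /andP[/existsP[e vu] pth].
have [c pc] := IH _ pth.
have [d pd] : exists d, boundary (R := R) d = point_mass u - point_mass v.
  case/orP: vu => /andP[/eqP <- /eqP <-].
    by exists [ffun e' => (e' == e)%:R]; exact: boundary_edge.
  exists (- [ffun e' => (e' == e)%:R]).
  by rewrite linearN /= boundary_edge opprB.
by exists (c + d); rewrite linearD /= pc pd addrA subrK.
Qed.

(** Relative to a fixed vertex o, a function g of total 0 is the combination
    of the differences v - o with coefficients g(v), and connectedness makes
    each of them a boundary. *)
Lemma boundary_onto (g : {ffun vertex G -> R^o}) : connected_graph G ->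
  \sum_v g v = 0 -> exists c, boundary c = g.
Proof.
move=> conn g0.
have /choice[c cE] : forall v, exists c,
    boundary (R := R) c = point_mass v - point_mass (basepoint G).
  by move=> v; apply: boundary_path; exact: conn.
exists (\sum_v g v *: c v); rewrite linear_sum /=.
under eq_bigr do rewrite linearZ /= cE scalerBr.
rewrite sumrB -scaler_suml g0 scale0r subr0.
apply/ffunP => u; rewrite sum_ffunE (bigD1 u)//= !ffunE eqxx big1 ?addr0.
  by rewrite /GRing.scale/= mulr1.
by move=> v vu; rewrite !ffunE eq_sym (negbTE vu) scaler0.
Qed.

End Balance.

(** * Borel sets of the geometric realization *)

Section Realization.
Variables (R : realType) (G : multigraph).
Implicit Types (e : edge G) (v : vertex G) (b : bool) (A : set (\bar R)).

Lemma edge_path_continuous e :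
  continuous (edge_path e : \bar R -> realization R G).
Proof. by apply/continuousP => U oU; exact: oU. Qed.

Lemma edge_path_cvg b e :
  edge_path e t%:E @[t --> to_end b] --> vertex_pt R (edge_end b e).
Proof.
have -> : vertex_pt R (edge_end b e) = edge_path e (if b then +oo%E else -oo%E).
  by case: b.
apply: (cvg_comp EFin (edge_path e)); last exact: edge_path_continuous.
by case: b; [apply/cvgeryP | apply/cvgerNyP]; exact: cvg_id.
Qed.

Lemma closed_finite A : finite_set A -> closed A.
Proof.
move: A; apply/accessible_finite_set_closed/hausdorff_accessible.
exact: ereal_hausdorff.
Qed.

Lemma closed_realization (X : set (realization R G)) :
  (forall e, closed (edge_path e @^-1` X)) -> closed X.
Proof.
move=> clX; rewrite -openC; suff : realization_open (~` X) by [].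
by move=> e; rewrite preimage_setC openC; exact: clX.
Qed.

Lemma edge_path_fin e e' (r : R) (u : \bar R) :
  edge_path e u = edge_path e' r%:E -> e = e' /\ u = r%:E.
Proof. by case: u => [s||] //= [-> ->]. Qed.

(** In the coordinate of any edge, the preimage of the image of A differs from
    A or from the empty set at the two endpoints only, hence is closed. *)
Lemma closed_edge_image e A : closed A ->
  closed (edge_path e @` A : set (realization R G)).
Proof.
move=> clA; apply: closed_realization => e'.
set Y := _ @^-1` _.
have -> : Y = (if e' == e then A else set0) `|` (Y `&` [set -oo%E; +oo%E]).
  apply/seteqP; split=> [u Yu|u [Au|[]//]]; last first.
    by move: Au; case: eqP => // ee Au; rewrite /Y ee; exists u.
  case: u Yu => [r|Yu|Yu]; last 2 first.
  - by right; split=> //; right.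
  - by right; split=> //; left.
  by move=> [u Au] /edge_path_fin[ee ur]; left; rewrite ee eqxx -ur.
apply: closedU; first by case: eqP => // _; exact: closed0.
by apply: closed_finite; apply: sub_finite_set (@subIsetr _ _ _) _.
Qed.

Lemma closed_measurable (X : set (realization R G)) : closed X ->
  measurable (X : set (borel_realization R G)).
Proof.
move=> clX; rewrite -[X]setCK; apply: measurableC.
by apply: sub_sigma_algebra; rewrite /= openC.
Qed.

Lemma measurable_segment e (s t : \bar R) :
  measurable (segment e s t : set (borel_realization R G)).
Proof.
rewrite /segment (_ : mkset _ = [set u | (s <= u)%E] `&` [set u | (u <= t)%E]).
  apply: closed_measurable; apply: closed_edge_image; apply: closedI.
    exact: closed_ereal_le_ereal.
  exact: closed_ereal_ge_ereal.
by apply/seteqP; split=> u /= => [/andP[]|[-> ->]].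
Qed.

Lemma measurable_vertex v :
  measurable ([set vertex_pt R v] : set (borel_realization R G)).
Proof.
apply: closed_measurable; apply: closed_realization => e.
apply: closed_finite; apply: (@sub_finite_set _ _ [set -oo%E; +oo%E]) => //.
by case=> [r||]//= _; [right|left].
Qed.

Lemma segment1 e (s : \bar R) : segment e s s = [set edge_path e s].
Proof.
apply/seteqP; split=> [p [u /= us <-]|p ->]; last first.
  by exists s => //=; rewrite !lexx.
by congr edge_path; apply/eqP; rewrite eq_le andbC.
Qed.

Lemma measurable_realfun_continuous (f : realization R G -> R) : continuous f ->
  measurable_fun setT (f : borel_realization R G -> R).
Proof.
move=> cf _.
apply: (measurability _ (measurable_realfun.RGenOpens.measurableE R)) => //.
move=> _ [_ [x [y ->]] <-]; rewrite setTI; apply: sub_sigma_algebra.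
by move/continuousP : cf; apply; exact: interval_open.
Qed.

Lemma measurable_end_segment b e (t : R) :
  measurable (end_segment b e t : set (borel_realization R G)).
Proof. by case: b; exact: measurable_segment. Qed.

Lemma segment_split e (s t u : \bar R) : (s <= t <= u)%E ->
  segment e s u = segment e s t `|` segment e t u.
Proof.
move=> /andP[st tu]; apply/seteqP; split=> [p [x /= /andP[sx xu] <-]|p].
  by case/orP: (le_total x t) => xt; [left|right]; exists x => //=; apply/andP.
case=> -[x /= /andP[l r] <-]; exists x => //=; apply/andP; split=> //.
  exact: le_trans tu.
exact: le_trans l.
Qed.

Lemma end_segment_sub b e (t : R) :
  (end_segment b e t : set (realization R G)) `<=` segment e -oo +oo.
Proof. by case: b => p [u _ <-]; exists u => //=; rewrite leNye leey. Qed.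

Lemma end_segment_homo b e (s t : R) : (if b then s <= t else t <= s) ->
  end_segment b e t `<=` end_segment b e s.
Proof.
case: b => st p [u /= /andP[l r] <-]; exists u => //=; apply/andP; split=> //.
  by apply: le_trans l; rewrite lee_fin.
by apply: le_trans r _; rewrite lee_fin.
Qed.

End Realization.

(** * The logarithmic term *)

Section Asymptotics.
Variable R : realType.
Implicit Types (z : R) (psi g : R -> R).

Lemma smooth_near_derivable z g : smooth_near z g -> derivable g z 1.
Proof. by case=> D Dz [_ sg]; exact: (sg 0%N z (nbhs_singleton Dz)). Qed.

Lemma derivable_continuous z g : derivable g z 1 -> {for z, continuous g}.
Proof. by move/derivable1_diffP/differentiable_continuous. Qed.

(** The bound ln x < x at x = 1 / sqrt |z| gives - ln |z| <= 2 / sqrt |z|. *)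
Lemma norm_xlnx_le z : z != 0 -> `|z| <= 1 ->
  `|z * ln `|z| | <= 2 * Num.sqrt `|z|.
Proof.
rewrite normrM -normr_gt0; set y := `|z| => y0 y1.
have s0 : 0 < Num.sqrt y by rewrite sqrtr_gt0.
have yE : y = Num.sqrt y ^+ 2 by rewrite sqr_sqrtr// ltW.
have lnE : `|ln y| = 2 * - ln (Num.sqrt y).
  by rewrite ler0_norm ?ln_le0// {1}yE lnXn// -mulNrn mulr_natl.
have /ltW h : ln (Num.sqrt y)^-1 < (Num.sqrt y)^-1.
  by apply/ln_sublinear; rewrite invr_gt0.
rewrite lnE {1}yE mulrCA ler_pM2l// expr2 -mulrA ger_pMr//.
rewrite -(mulfV (lt0r_neq0 s0)).
by rewrite ler_pM2l// -lnV.
Qed.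

Lemma xlnx_cvg0 : z * ln `|z| @[z --> (0 : R)^'] --> (0 : R).
Proof.
have norm0 : `|z| @[z --> (0 : R)^'] --> (0 : R).
  by rewrite -{2}(@normr0 _ R); apply: cvg_within_filter; exact: norm_continuous.
have sqrt0 : 2 * Num.sqrt `|z| @[z --> (0 : R)^'] --> (0 : R).
  rewrite -[X in _ --> X](mulr0 2); apply: cvgMl_tmp.
  by rewrite -{2}(@sqrtr0 R); apply: (cvg_comp _ _ norm0); exact: sqrt_continuous.
apply: norm_cvg0; apply: (squeeze_cvgr _ (cvg_cst 0) sqrt0).
near=> z; rewrite normr_ge0 norm_xlnx_le//.
  by near: z; exact: nbhs_dnbhs_neq.
by near: z; exact: cvgr_le norm0 _ ltr01.
Unshelve. all: by end_near.
Qed.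

(** The product splits into psi(z) / z, which tends to psi'(0), and
    z ln |z|, which tends to 0. *)
Lemma smooth_log_cvg0 psi : smooth_near 0 psi -> psi 0 = 0 ->
  psi z * ln `|z| @[z --> (0 : R)^'] --> (0 : R).
Proof.
move=> /smooth_near_derivable/cvg_ex[/= d dq] psi0.
have : (z^-1 * psi z) * (z * ln `|z|) @[z --> (0 : R)^'] --> (0 : R).
  rewrite -[X in _ --> X](mulr0 d); apply: cvgM xlnx_cvg0.
  apply: cvg_trans dq; apply: near_eq_cvg; near=> z.
  by rewrite addr0 psi0 subr0 /GRing.scale/= mulr1.
apply: cvg_trans; apply: near_eq_cvg; near=> z.
rewrite mulrACA mulVf ?mul1r//; near: z; exact: nbhs_dnbhs_neq.
Unshelve. all: by end_near.
Qed.

End Asymptotics.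

(** * Half-edges at a vertex *)

Section Tripods.
Variable G : multigraph.
Implicit Types (v : vertex G) (e : edge G) (b : bool).

Lemma valence_stars b v : valence v = (#|star b v| + #|star (~~ b) v|)%N.
Proof. by case: b; rewrite /= /valence // addnC. Qed.

(** A vertex of a tripod has only three half-edges, so counting shows that the
    trunk and the branches exhaust both stars. *)
Lemma tripod_stars v b e0 e1 e2 : tripod v b e0 e1 e2 ->
  [/\ star b v = [set e0]%SET, star (~~ b) v = [set e1; e2]%SET & e1 != e2].
Proof.
case=> v3 s0 s1 s2 /eqP ne.
have i0 : [set e0]%SET \subset star b v by rewrite finset.sub1set mem_star s0.
have i12 : [set e1; e2]%SET \subset star (~~ b) v.
  by rewrite finset.subUset !finset.sub1set !mem_star s1 s2 eqxx.
have c0 := subset_leq_card i0; have c12 := subset_leq_card i12.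
have cc := valence_stars b v.
rewrite v3 in cc; rewrite cards1 in c0; rewrite cards2 ne in c12.
split=> //; apply/esym/eqP; rewrite eqEcard ?i0 ?i12 ?cards1 ?cards2 ?ne /=; lia.
Qed.

Lemma tripod_end v b e0 e1 e2 b' e : tripod v b e0 e1 e2 ->
  edge_end b' e = v ->
  [\/ b' = b /\ e = e0, b' = ~~ b /\ e = e1 | b' = ~~ b /\ e = e2].
Proof.
move=> /tripod_stars[S0 S12 _] /eqP; rewrite -mem_star.
have [->|nb] := eqVneq b' b.
  by rewrite S0 inE => /eqP ->; constructor 1.
have -> : b' = ~~ b by case: (b') (b) nb => [] [].
by rewrite S12 !inE => /orP[] /eqP ->; [constructor 2|constructor 3].
Qed.

End Tripods.

Section TrivalentVertices.
Variables (R : realType) (G : measured_reeb_graph R).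
Implicit Type v : vertex G.

Lemma trivalent_stars v : valence v = 3%N ->
  exists b, #|star b v| = 1%N /\ #|star (~~ b) v| = 2%N.
Proof. by case/trivalentP => -[din dout]; [exists false|exists true]. Qed.

Lemma exists_tripod v : valence v = 3%N -> exists b e0 e1 e2, tripod v b e0 e1 e2.
Proof.
move=> v3; have [b [/eqP/cards1P[e0 E0] /eqP/cards2P[e1 [e2 [ne E12]]]]] :=
  trivalent_stars v3.
exists b, e0, e1, e2; split=> //; last exact/eqP.
- by apply/eqP; rewrite -mem_star E0 set11.
- by apply/eqP; rewrite -mem_star E12 set21.
- by apply/eqP; rewrite -mem_star E12 set22.
Qed.

End TrivalentVertices.

(** * Mass near the ends of an edge *)

#[local] Instance to_end_filter (R : realType) b : ProperFilter (@to_end R b).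
Proof. by case: b; rewrite /to_end; typeclasses eauto. Qed.

Section Ends.
Variables (R : realType) (G : measured_reeb_graph R).
Implicit Types (v : vertex G) (e : edge G) (b : bool).
Local Notation mu := (@mass R G).

Lemma height_mono e : {mono (fun u : \bar R => height (edge_path e u)) :
  s t / (s <= t)%E >-> s <= t}.
Proof. exact/le_mono/height_increasing. Qed.

Lemma height_cvg b e :
  height (edge_path e t%:E) @[t --> to_end b]
    --> height (vertex_pt R (edge_end b e)).
Proof.
apply: (cvg_comp (fun t : R => edge_path e t%:E) (@height R G)).
  exact: edge_path_cvg.
exact: height_continuous.
Qed.

(** The limit is along punctured neighbourhoods, as the logarithm requires:
    strict monotonicity keeps the height of an interior point away from that
    of the vertex. *)
Lemma height_to_vertex b e :
  height (edge_path e t%:E) - height (vertex_pt R (edge_end b e))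
    @[t --> to_end b] --> (0 : R)^'.
Proof.
move=> A; rewrite /dnbhs /within /= => /= /nbhs_ballP[d d0 dA].
have /cvgrPdist_lt/(_ d d0) := @height_cvg b e.
apply: filterS => t td; apply: dA => /=.
  by rewrite /ball /= sub0r normrN distrC.
have lt1 := @height_increasing _ _ e -oo%E t%:E (ltNyr t).
have lt2 := @height_increasing _ _ e t%:E +oo%E (ltry t).
rewrite subr_eq0; case: b {td} => /=; last by rewrite gt_eqF.
by rewrite lt_eqF.
Qed.

(** The logarithmic term vanishes in the limit and only eta(0) survives. *)
Lemma expansion_cvg b e eps psi eta : smooth_near 0 psi -> smooth_near 0 eta ->
  psi 0 = 0 -> log_expansion (@height R G) mu b e eps psi eta ->
  mu (end_segment b e t) @[t --> to_end b] --> (eta 0)%:E.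
Proof.
move=> spsi seta psi0 ex.
have cv : eps * psi z * ln `|z| + eta z @[z --> (0 : R)^'] --> eta 0.
  rewrite -[X in _ --> X]add0r -[X in X + _](mulr0 eps); apply: cvgD; last first.
    apply: cvg_within_filter; apply: derivable_continuous.
    exact: smooth_near_derivable.
  under eq_fun do rewrite -mulrA.
  by apply: cvgMl_tmp; exact: smooth_log_cvg0.
have {}cv := cvg_comp _ _ (@height_to_vertex b e) cv.
apply/fine_cvgP; split; first by apply: filterS ex => t /= ->.
by apply: cvg_trans cv; apply: near_eq_cvg; apply: filterS ex => t /= ->.
Qed.

(** Whichever of trunk and branches a half-edge at a 3-valent vertex is, it
    inherits one of the three expansions. *)
Lemma log_expansion_end b e : valence (edge_end b e) = 3%N ->
  exists eps psi eta, [/\ smooth_near 0 psi, smooth_near 0 eta, psi 0 = 0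
    & log_expansion (@height R G) mu b e eps psi eta].
Proof.
move=> v3; have [b' [e0 [e1 [e2 tri]]]] := exists_tripod v3.
have [psi [eta0 [eta1 [eta2]]]] := mass_trivalent tri.
move=> [[sp s0 s1 s2] [x0 x1 x2] p0 _ _].
have [[-> ->]|[-> ->]|[-> ->]] := tripod_end tri (erefl (edge_end b e)).
- by exists 2, psi, eta0.
- by exists (-1), psi, eta1.
- by exists (-1), psi, eta2.
Qed.

(** The function eta gives every initial segment a finite mass, which leaves
    the part near the target: at a 3-valent target a terminal segment
    has finite mass by the logarithmic expansion; at a 1-valent one the masses
    eta(f(x)) of the initial segments converge, eta being continuous up to the
    target, and the target itself is null. *)
Lemma mass_edge_fin e : (mu (segment e -oo +oo) < +oo)%E.
Proof.
have [eta [_ mE _ _ up]] := mass_edge e.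
have lowfin t : (mu (segment e -oo t%:E) < +oo)%E by rewrite (mE t) ltry.
have [w1|w3] := valenceP (tgt e); last first.
  have [eps [psi [eta' [_ _ _ ex]]]] := @log_expansion_end true e w3.
  have [t tE] := filter_ex ex.
  have upfin : (mu (end_segment true e t) < +oo)%E by rewrite tE ltry.
  rewrite (@segment_split _ _ _ _ t%:E) ?leNye ?leey//.
  apply: le_lt_trans (measureU2 _ _ _) _; try exact: measurable_segment.
  exact: lte_add_pinfty (lowfin t) upfin.
have [/smooth_near_derivable/derivable_continuous etaw _] := up w1.
pose F n := segment e -oo (n%:R : R)%:E : set (borel_realization R G).
have mF n : measurable (F n) by exact: measurable_segment.
have cover : segment e -oo +oo `<=` \bigcup_n F n `|` [set vertex_pt R (tgt e)].
  move=> p [[r||] /= _ <-]; last 2 first.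
  - by right.
  - by left; exists 0%N => //; exists -oo%E => //=; exact: leNye.
  (* the interior point at r lies in F n for every integer n > |r| *)
  left; exists (Num.truncn `|r|).+1 => //; exists r%:E => //=.
  rewrite leNye /= lee_fin.
  by apply: le_trans (ler_norm r) _; apply/ltW; apply: truncnS_gt.
have mUF : measurable (\bigcup_n F n) by exact: bigcupT_measurable.
have limF : (mu \o F) n @[n --> \oo] --> mu (\bigcup_n F n).
  apply: nondecreasing_cvg_mu => // m n mn; apply/subsetPset => p [u /= um <-].
  exists u => //=; case/andP: um => -> /= /le_trans; apply.
  by rewrite lee_fin ler_nat.
have limE : (mu \o F) n @[n --> \oo] --> (eta (height (vertex_pt R (tgt e))))%:E.
  apply/fine_cvgP; split; first by near=> n; rewrite /= (mE n%:R).
  rewrite (_ : fine \o _ =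
    (fun t => eta (height (edge_path e t%:E))) \o (fun n => n%:R)).
    apply: (cvg_comp _ _ (@cvgr_idn R)).
    apply: (cvg_comp (fun t : R => height (edge_path e t%:E)) eta).
      exact: (@height_cvg true e).
    exact: etaw.
  by apply/funext => n /=; rewrite (mE n%:R).
have muF : mu (\bigcup_n F n) = (eta (height (vertex_pt R (tgt e))))%:E.
  by apply: cvg_unique limF limE; exact: ereal_hausdorff.
apply: le_lt_trans (le_measure mu _ _ cover) _; rewrite ?inE.
- exact: measurable_segment.
- by apply: measurableU => //; exact: measurable_vertex.
have muU := etrans (measureU0 mUF (measurable_vertex _) (mass_univalent w1)) muF.
by have := ltry (eta (height (vertex_pt R (tgt e)))); rewrite -muU; apply.
Unshelve. all: by end_near.
Qed.

End Ends.

(** * Points carry no mass *)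

Section NullPoints.
Variables (R : realType) (G : measured_reeb_graph R).
Implicit Types (v : vertex G) (e : edge G) (b : bool).
Local Notation mu := (@mass R G).
Local Notation space := (borel_realization R G).

Lemma mass_end_fin b e t : mu (end_segment b e t) \is a fin_num.
Proof.
rewrite ge0_fin_numE//; apply: le_lt_trans (mass_edge_fin e).
apply: le_measure; rewrite ?inE; [exact: measurable_end_segment| |].
  exact: measurable_segment.
exact: end_segment_sub.
Qed.

Lemma edge_path_inj e : injective (edge_path e : \bar R -> realization R G).
Proof.
move=> x y xy; apply: (mono_inj lexx le_anti (@height_mono _ _ e)).
by rewrite xy.
Qed.

Lemma end_segment_bigcap b e :
  \bigcap_n end_segment b e (if b then n%:R else - n%:R : R)
    = [set vertex_pt R (edge_end b e)].
Proof.
apply/seteqP; split=> [p cap|p -> n _]; last first.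
  by case: b; [exists +oo%E|exists -oo%E] => //=; rewrite ?leNye ?leey.
have [u uE] : exists u, edge_path e u = p.
  by case: (b) (cap 0%N I) => -[u _ <-]; exists u.
have {}cap n : if b then (n%:R%:E <= u)%E else (u <= (- n%:R)%:E)%E.
  have := cap n I; rewrite -uE.
  by case: b {cap} => -[x /= /andP[l r] /edge_path_inj <-].
rewrite -uE; case: u {uE} cap => [r||] cap.
- (* an interior point violates the bound for any integer n > |r| *)
  exfalso; have := cap (Num.truncn `|r|).+1.
  have := truncnS_gt `|r|.
  case: b {cap} => lt; rewrite /= lee_fin; apply/negP; rewrite -ltNge.
    exact: le_lt_trans (ler_norm _) lt.
  by rewrite ltrNl (le_lt_trans (ler_norm _))// normrN.
- by case: b cap => // /(_ 0%N).
- by case: b cap => // /(_ 0%N).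
Qed.

(** Continuity from above gives the limit along integer parameters, and
    monotonicity of the mass extends it to real ones. *)
Lemma end_mass_cvg_vertex b e :
  mu (end_segment b e t) @[t --> to_end b]
    --> mu [set vertex_pt R (edge_end b e)].
Proof.
pose s (n : nat) : R := if b then n%:R else - n%:R.
have seqcvg : (mu \o (fun n => end_segment b e (s n))) n @[n --> \oo]
    --> mu [set vertex_pt R (edge_end b e)].
  rewrite -(end_segment_bigcap b e); apply: nonincreasing_cvg_mu.
  - by rewrite -ge0_fin_numE//; exact: mass_end_fin.
  - by move=> n; exact: measurable_end_segment.
  - by rewrite end_segment_bigcap; exact: measurable_vertex.
  - move=> m n mn; apply/subsetPset; apply: end_segment_homo.
    by rewrite /s; case: (b); rewrite ?lerN2 ler_nat.
have sub t : [set vertex_pt R (edge_end b e)] `<=` end_segment b e t.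
  move=> _ ->; rewrite /end_segment; case: (b).
    by exists +oo%E => //=; rewrite !leey.
  by exists -oo%E => //=; rewrite !leNye.
have le_mu t : (mu [set vertex_pt R (edge_end b e)] <= mu (end_segment b e t))%E.
  apply: le_measure; rewrite ?inE //; [exact: measurable_vertex|].
  exact: measurable_end_segment.
have finv : mu [set vertex_pt R (edge_end b e)] \is a fin_num.
  rewrite ge0_fin_numE//; apply: le_lt_trans (le_mu 0) _.
  by rewrite -ge0_fin_numE// mass_end_fin.
rewrite -(fineK finv); apply/fine_cvgP; split.
  by near=> t; exact: mass_end_fin.
apply/cvgrPdist_le => d d0.
move: seqcvg; rewrite -(fineK finv) => /fine_cvgP[_ /cvgrPdist_le/(_ d d0)].
move=> /filter_ex[n dn].
have near_end : \forall t \near to_end b, if b then s n <= t else t <= s n.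
  by rewrite /to_end; case: (b) (s n) => r;
    [apply: nbhs_pinfty_ge|apply: nbhs_ninfty_le]; exact: num_real.
apply: filterS near_end => t /(@end_segment_homo _ _ b e) tn.
have le_t := fine_le finv (mass_end_fin b e t) (le_mu t).
have le_n := fine_le finv (mass_end_fin b e (s n)) (le_mu (s n)).
have tn_mu : fine (mu (end_segment b e t)) <= fine (mu (end_segment b e (s n))).
  apply: fine_le; rewrite ?mass_end_fin//.
  apply: le_measure; rewrite ?inE; try exact: measurable_end_segment.
  exact: tn.
apply: le_trans dn; rewrite /= !ler0_norm ?subr_le0//.
by rewrite !opprB lerD2r.
Unshelve. all: by end_near.
Qed.

(** Comparing the two descriptions of the limit of mu [v, x] at a 3-valent
    vertex shows eta_0(0) = eta_1(0) = eta_2(0) = mu {v}, while these three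
    numbers add up to 0. *)
Lemma mass_vertex v : mu [set vertex_pt R v] = 0%E.
Proof.
have [|v3] := valenceP v; first exact: mass_univalent.
have [b [e0 [e1 [e2 tri]]]] := exists_tripod v3.
have [psi [eta0 [eta1 [eta2]]]] := mass_trivalent tri.
move=> [[sp s0 s1 s2] [x0 x1 x2] p0 _ eta_sum].
have [_ v0 v1 v2 _] := tri.
have eta_mass b' e eps eta : edge_end b' e = v -> smooth_near 0 eta ->
    log_expansion (@height R G) mu b' e eps psi eta ->
    mu [set vertex_pt R v] = (eta 0)%:E.
  move=> ve se xe; have := @end_mass_cvg_vertex b' e; rewrite ve => c1.
  have c2 := expansion_cvg sp se p0 xe.
  by apply: cvg_unique c1 c2; exact: ereal_hausdorff.
have m0 := eta_mass _ _ _ _ v0 s0 x0.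
have [m1] := etrans (esym m0) (eta_mass _ _ _ _ v1 s1 x1).
have [m2] := etrans (esym m0) (eta_mass _ _ _ _ v2 s2 x2).
have := nbhs_singleton eta_sum; rewrite -m1 -m2 m0 => h.
by congr EFin; lra.
Qed.

(** For t < s the mass of the point at s is at most that of [v, s] minus that
    of [v, t], that is eta(f(s)) - eta(f(t)), which tends to 0 as t increases
    to s. *)
Lemma mass_interior e (s : R) : mu [set edge_path e s%:E] = 0%E.
Proof.
have [eta [seta mE _ _ _]] := mass_edge e.
have ctseta : {for height (edge_path e s%:E), continuous eta}.
  apply: derivable_continuous; apply: (seta 0%N) => /=.
  apply/andP; split; first exact: (@height_increasing _ _ e -oo%E s%:E (ltNyr s)).
  exact: (@height_increasing _ _ e s%:E +oo%E (ltry s)).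
have mpt : measurable ([set edge_path e s%:E] : set space).
  by rewrite -segment1; exact: measurable_segment.
have msub t : t < s -> (mu [set edge_path e s%:E] <=
   (eta (height (edge_path e s%:E)) - eta (height (edge_path e t%:E)))%:E)%E.
  move=> ts; rewrite EFinB -!mE leeBrDr ?mass_end_fin//.
  have := @measureU _ _ _ mu _ _ mpt (measurable_end_segment false e t).
  move=> <-; last first.
    rewrite -subset0 => p [/= -> [u /= /andP[_ ut] /edge_path_fin[_ us]]].
    by move: ut; rewrite us lee_fin leNgt ts.
  apply: le_measure; rewrite ?inE.
  - by apply: measurableU => //; exact: measurable_end_segment.
  - exact: measurable_end_segment.
  - move=> p [->|]; first by exists s%:E => //=; rewrite leNye lexx.
    by apply: end_segment_homo; exact/ltW.
have fin : mu [set edge_path e s%:E] \is a fin_num.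
  rewrite ge0_fin_numE//; apply: le_lt_trans (msub (s - 1) _) (ltry _).
  by rewrite ltrBlDr ltrDl.
apply/eqP; rewrite eq_le measure_ge0 andbT -(fineK fin) lee_fin.
have cv : eta (height (edge_path e s%:E)) - eta (height (edge_path e t%:E))
    @[t --> s^'-] --> (0 : R).
  rewrite -[X in _ --> X](subrr (eta (height (edge_path e s%:E)))).
  apply: cvgB; first exact: cvg_cst.
  apply: (cvg_comp (fun t : R => height (edge_path e t%:E)) eta); last first.
    exact: ctseta.
  apply: (cvg_comp (fun t : R => edge_path e t%:E) (@height R G)); last first.
    exact: height_continuous.
  apply: (cvg_comp EFin (edge_path e)); last exact: edge_path_continuous.
  by apply: cvg_within_filter => A /nbhs_EFin.
apply: (cvgr_to_ge cv); near=> t; rewrite -lee_fin fineK//; apply: msub.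
by near: t; exact: nbhs_left_lt.
Unshelve. all: by end_near.
Qed.

End NullPoints.

(** * The signed mass of a Borel set *)

Section SignedMass.
Variables (R : realType) (G : measured_reeb_graph R).
Implicit Types (v : vertex G) (e : edge G) (b : bool).
Local Notation mu := (@mass R G).
Local Notation space := (borel_realization R G).
Implicit Types (A B : set space).
Local Notation f := (@height R G).

(** Along an edge the height stays between its values at the two ends. *)
Lemma height_bounded :
  exists2 M, 0 <= M & forall p : realization R G, `|f p| <= M.
Proof.
pose M := \sum_(v : vertex G) `|f (vertex_pt R v)|; exists M.
  by apply: sumr_ge0.
have vM v : `|f (vertex_pt R v)| <= M.
  by rewrite /M (bigD1 v)//= lerDl sumr_ge0.
move=> [v|[e r]]; first exact: vM.
have := @height_increasing _ _ e -oo%E r%:E (ltNyr r).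
have := @height_increasing _ _ e r%:E +oo%E (ltry r).
have := vM (src e); have := vM (tgt e); rewrite !ler_norml /=; lra.
Qed.

Definition edges_union (s : seq (edge G)) : set space :=
  \big[setU/set0]_(e <- s) segment e -oo +oo.

Definition vertex_set : set space := \big[setU/set0]_v [set vertex_pt R v].

Lemma measurable_edges_union s : measurable (edges_union s).
Proof. by apply: bigsetU_measurable => e _; exact: measurable_segment. Qed.

Lemma measurable_vertex_set : measurable vertex_set.
Proof. by apply: bigsetU_measurable => v _; exact: measurable_vertex. Qed.

Lemma vertex_setP v : vertex_set (vertex_pt R v).
Proof.
by rewrite /vertex_set -bigcup_seq; exists v => //=; exact: mem_index_enum.
Qed.

Lemma mass_vertex_set : mu vertex_set = 0%E.
Proof.
rewrite /vertex_set; elim: (index_enum _) => [|v s IH].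
  by rewrite big_nil measure0.
rewrite big_cons setUC.
have ms : measurable (\big[setU/set0]_(v <- s) [set vertex_pt R v] : set space).
  by apply: bigsetU_measurable => w _; exact: measurable_vertex.
exact: etrans (measureU0 ms (measurable_vertex v) (mass_vertex v)) IH.
Qed.

Lemma realization_cover : edges_union (index_enum (edge G)) `|` vertex_set = setT.
Proof.
apply/seteqP; split=> // -[v _|[e r] _]; [right; exact: vertex_setP|left].
rewrite /edges_union -bigcup_seq; exists e => /=; first exact: mem_index_enum.
by exists r%:E => //=; rewrite leNye leey.
Qed.

Lemma mass_fin A : measurable A -> mu A \is a fin_num.
Proof.
move=> mA; rewrite ge0_fin_numE//.
apply: (@le_lt_trans _ _ (mu setT)); first by apply: le_measure; rewrite ?inE.
rewrite -realization_cover.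
apply: (le_lt_trans (measureU2 _ (measurable_edges_union _) _)).
  exact: measurable_vertex_set.
apply: lte_add_pinfty; last first.
  by apply: (@le_lt_trans _ _ 0%E) => //; rewrite -mass_vertex_set.
elim: (index_enum _) => [|e s IH].
  by rewrite /edges_union big_nil measure0 ltry.
rewrite /edges_union big_cons.
apply: le_lt_trans (measureU2 _ (measurable_segment _ _ _) _) _.
  exact: measurable_edges_union.
exact: lte_add_pinfty (mass_edge_fin e) IH.
Qed.

Lemma integrable_height A : measurable A -> mu.-integrable A (EFin \o f).
Proof.
move=> mA; apply: measurable_bounded_integrable => //.
- by rewrite -ge0_fin_numE// mass_fin.
- apply: measurable_funTS; apply: measurable_realfun_continuous.
  exact: height_continuous.
- have [M M0 hM] := height_bounded.
  exists M; split; first exact: num_real.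
  by move=> x Mx p _; apply: le_trans (hM p) (ltW Mx).
Qed.

(** The signed measure f dmu. *)
Definition moment A : R := \int[mu]_(p in A) f p.

Lemma moment_le : exists2 M, 0 <= M &
  forall A, measurable A -> `|moment A| <= M * fine (mu A).
Proof.
have [M M0 hM] := height_bounded; exists M => // A mA.
apply: le_trans (le_normr_Rintegral mA (integrable_height mA)) _.
rewrite -Rintegral_cst//; apply: le_Rintegral => //.
- exact/integrable_norm/integrable_height.
- apply: measurable_bounded_integrable => //; last exact: bounded_cst.
  by rewrite -ge0_fin_numE// mass_fin.
Qed.

Lemma moment_null A : measurable A -> mu A = 0%E -> moment A = 0.
Proof.
move=> mA A0; have [M _ /(_ _ mA)] := moment_le.
by rewrite A0 mulr0 normr_le0 => /eqP.
Qed.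

Lemma moment_disjointU A B : measurable A -> measurable B -> A `&` B = set0 ->
  moment (A `|` B) = moment A + moment B.
Proof.
move=> mA mB AB; apply: Rintegral_setU => //; last exact/disj_set2P.
by apply: integrable_height; exact: measurableU.
Qed.

(** A null overlap suffices for additivity, so that closed segments with a
    common endpoint can be glued and the closed edges of the graph be treated
    as disjoint. *)
Lemma momentU A B : measurable A -> measurable B -> mu (A `&` B) = 0%E ->
  moment (A `|` B) = moment A + moment B.
Proof.
move=> mA mB AB0; have mBA : measurable (B `\` A) by exact: measurableD.
have mAB : measurable (A `&` B) by exact: measurableI.
have UE : A `|` B = A `|` (B `\` A).
  apply/seteqP; split=> p; last by case=> [|[]]; [left|right].
  by have [|] := pselect (A p); [left|move=> nA []//; right].
have BE : B = (A `&` B) `|` (B `\` A).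
  apply/seteqP; split=> p; last by case=> -[].
  by have [|] := pselect (A p); [left|right].
rewrite UE moment_disjointU//; last first.
  by rewrite -subset0 => p [Ap []].
rewrite [in RHS]BE moment_disjointU ?(moment_null mAB AB0) ?add0r//.
by rewrite -subset0 => p [[Ap _] []].
Qed.

Lemma mass_point e (u : \bar R) : mu [set edge_path e u] = 0%E.
Proof.
by case: u => [s||]; [exact: mass_interior|exact: mass_vertex|
  exact: mass_vertex].
Qed.

Lemma moment_segment_split e (s t u : \bar R) : (s <= t <= u)%E ->
  moment (segment e s u) = moment (segment e s t) + moment (segment e t u).
Proof.
move=> stu; rewrite (segment_split e stu).
apply: momentU; try exact: measurable_segment.
rewrite (_ : _ `&` _ = [set edge_path e t]); first exact: mass_point.
case/andP: stu => st tu; apply/seteqP; split=> [p [[x /= /andP[_ xt] xE]]|p ->].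
  move=> [y /= /andP[ty _]]; rewrite -xE => /edge_path_inj yx.
  by rewrite yx in ty *; congr edge_path; apply/le_anti; rewrite xt ty.
by split; exists t => //=; rewrite ?lexx ?st ?tu.
Qed.

(** Distinct closed edges meet in vertices only, hence in a null set. *)
Lemma moment_edges_union s : uniq s ->
  moment (edges_union s) = \sum_(e <- s) moment (segment e -oo +oo).
Proof.
elim: s => [_|e s IH /= /andP[es us]].
  by rewrite /edges_union !big_nil moment_null// measure0.
rewrite big_cons -(IH us) /edges_union big_cons.
apply: momentU; [exact: measurable_segment|exact: measurable_edges_union|].
apply: (subset_measure0 _ measurable_vertex_set) mass_vertex_set.
  apply: measurableI; first exact: measurable_segment.
  exact: measurable_edges_union.
move=> p [[[r||] /= _ <-]]; last 2 first.
- by move=> _; exact: vertex_setP.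
- by move=> _; exact: vertex_setP.
rewrite -bigcup_seq => -[e' /= e's [u _ /edge_path_fin[ee _]]].
by rewrite -ee e's in es.
Qed.

Lemma moment_setT : moment setT = \sum_e moment (segment e -oo +oo).
Proof.
rewrite -realization_cover momentU.
- rewrite moment_edges_union ?index_enum_uniq//.
  by rewrite (moment_null measurable_vertex_set mass_vertex_set) addr0.
- exact: measurable_edges_union.
- exact: measurable_vertex_set.
apply: (subset_measure0 _ measurable_vertex_set) mass_vertex_set.
  apply: measurableI; first exact: measurable_edges_union.
  exact: measurable_vertex_set.
exact: subIsetr.
Qed.

Lemma momentE A : measurable A -> (\int[mu]_(p in A) (f p)%:E)%E = (moment A)%:E.
Proof.
move=> mA; rewrite fineK//; apply: integrable_fin_num => //.
exact: integrable_height.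
Qed.

(** Additivity over adjacent segments needs the cut point to be null; the sign
    convention for reversed endpoints is absorbed by the difference. *)
Lemma edge_integralE e (s t : R) : edge_integral e s t =
  (moment (segment e -oo t%:E) - moment (segment e -oo s%:E))%:E.
Proof.
rewrite /edge_integral height_mono lee_fin; case: leP => st.
  rewrite momentE; last exact: measurable_segment.
  rewrite (@moment_segment_split e -oo s%:E t%:E) ?leNye ?lee_fin//.
  by rewrite addrAC subrr add0r.
rewrite momentE; last exact: measurable_segment.
rewrite (@moment_segment_split e -oo t%:E s%:E) ?leNye ?lee_fin ?ltW//.
by rewrite opprD addrA subrr add0r.
Qed.

Lemma end_moment_cvg0 b e :
  moment (end_segment b e t) @[t --> to_end b] --> (0 : R).
Proof.
have [M M0 hM] := moment_le.
have := @end_mass_cvg_vertex R G b e; rewrite mass_vertex => /fine_cvgP[_ mcv].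
apply: norm_cvg0.
have Mcv : M * fine (mu (end_segment b e t)) @[t --> to_end b] --> (0 : R).
  by rewrite -[X in _ --> X](mulr0 M); apply: cvgMl_tmp.
apply: (squeeze_cvgr _ (cvg_cst 0) Mcv); near=> t.
by rewrite normr_ge0 hM//; exact: measurable_end_segment.
Unshelve. all: by end_near.
Qed.

(** The initial segments exhaust the edge at its target and shrink to the null
    source at the other end. *)
Lemma moment_initial_cvg b e : moment (segment e -oo t%:E) @[t --> to_end b]
  --> (if b then moment (segment e -oo +oo) else 0).
Proof.
have := @end_moment_cvg0 b e; case: b => //= cv.
rewrite -[X in _ --> X]subr0.
rewrite (_ : (fun t => _) =
  fun t => moment (segment e -oo +oo) - moment (segment e t%:E +oo)).
  by apply: cvgB => //; exact: cvg_cst.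
apply/funext => t.
by rewrite (@moment_segment_split e -oo t%:E +oo) ?leNye ?leey// addrK.
Qed.

End SignedMass.

(** * Circulation functions *)

Section Circulations.
Variables (R : realType) (G : measured_reeb_graph R).
Implicit Types (v : vertex G) (e : edge G) (b : bool) (c : {ffun edge G -> R^o}).

Definition edge_moment e : R := moment (segment e -oo +oo).

(** By [circulation_of_cvg], c(e) is the limit of this function at the source
    of e. *)
Definition circulation_of c : interior_fun G :=
  fun p => c p.1 + moment (segment p.1 -oo p.2%:E).

Definition end_value c b e : R := if b then c e + edge_moment e else c e.

Lemma circulation_of_cvg c b e :
  circulation_of c (e, t) @[t --> to_end b] --> end_value c b e.
Proof.
have -> : end_value c b e = c e + (if b then edge_moment e else 0).
  by rewrite /end_value; case: b; rewrite ?addr0.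
by apply: (@cvgD R R^o); [exact: cvg_cst|exact: moment_initial_cvg].
Qed.

Lemma circulation_ofP (C : interior_fun G) :
  (forall e s t, (C (e, t) - C (e, s))%:E = edge_integral e s t) <->
  exists c, C = circulation_of c.
Proof.
split=> [Cint|[c ->] e s t]; last first.
  by rewrite edge_integralE /circulation_of /= opprD addrACA subrr add0r.
exists [ffun e => C (e, 0) - moment (segment e -oo 0%:E)].
apply/funext => -[e t]; rewrite /circulation_of /= ffunE.
have := Cint e 0 t; rewrite edge_integralE => -[].
move=> /(canRL (subrK _)) ->; ring.
Qed.

(** A conservation law for values x b e attached to half-edges, which covers
    1-valent vertices and both kinds of 3-valent ones at once. *)
Section Conservation.
Variable x : bool -> edge G -> R.

Definition balanced v :=
  \sum_(e in star true v) x true e = \sum_(e in star false v) x false e.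

Lemma balanced_sym b v : balanced v <->
  \sum_(e in star b v) x b e = \sum_(e in star (~~ b) v) x (~~ b) e.
Proof. by case: b => //=; split=> /esym. Qed.

Lemma balanced_univalent v b e : valence v = 1%N -> edge_end b e = v ->
  balanced v <-> x b e = 0.
Proof.
move=> v1 ev; rewrite (balanced_sym b).
have eb : e \in star b v by rewrite mem_star ev.
have : (0 < #|star b v|)%N by apply/card_gt0P; exists e.
have := valence_stars b v; rewrite v1 => cc c0.
have /cards1P[e' sE] : #|star b v| == 1%N by lia.
have /cards0_eq nE : #|star (~~ b) v| = 0%N by lia.
by move: eb; rewrite sE nE inE => /eqP ->; rewrite big_set1 big_set0.
Qed.

Lemma balanced_tripod v b e0 e1 e2 : tripod v b e0 e1 e2 ->
  balanced v <-> x b e0 = x (~~ b) e1 + x (~~ b) e2.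
Proof.
move=> /tripod_stars[s0 s12 ne]; rewrite (balanced_sym b) s0 s12 big_set1.
by rewrite big_setU1 ?inE//= big_set1.
Qed.

End Conservation.

Lemma exists_end v : exists b e, edge_end b e = v.
Proof.
have v0 : (0 < valence v)%N by case: (valenceP v) => ->.
have : (0 < #|star true v|)%N || (0 < #|star false v|)%N.
  by move: v0; rewrite (valence_stars true) addn_gt0.
by case/orP => /card_gt0P[e]; rewrite mem_star => /eqP ev;
  [exists true, e|exists false, e].
Qed.

Lemma circulation_of_balanced c :
  circulation_function (circulation_of c) <-> forall v, balanced (end_value c) v.
Proof.
have lim b e (l : R) : circulation_of c (e, t) @[t --> to_end b] --> l ->
    l = end_value c b e.
  move=> cl; apply: cvg_unique cl (@circulation_of_cvg c b e).
  exact: norm_hausdorff.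
split=> [[_ uni tri] v|bal].
  have [v1|v3] := valenceP v.
    have [b [e ev]] := exists_end v.
    by apply/(balanced_univalent _ v1 ev)/esym/lim; exact: uni ev.
  have [b [e0 [e1 [e2 t]]]] := exists_tripod v3.
  have [l0 [l1 [l2 [/lim c0 /lim c1 /lim c2]]]] := tri _ _ _ _ _ t.
  by rewrite c0 c1 c2 => /(balanced_tripod _ t).
split.
- by apply/circulation_ofP; exists c.
- move=> v b e v1 ev; have /(balanced_univalent _ v1 ev) <- := bal v.
  exact: circulation_of_cvg.
- move=> v b e0 e1 e2 t; exists (end_value c b e0).
  exists (end_value c (~~ b) e1), (end_value c (~~ b) e2).
  split; try exact: circulation_of_cvg.
  exact/(balanced_tripod _ t).
Qed.

(** What the constants c must deliver at v in order to balance the integrals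
    of f over the edges that end there. *)
Definition demand : {ffun vertex G -> R^o} :=
  [ffun v => - \sum_(e in star true v) edge_moment e].

Lemma balanced_boundary c :
  (forall v, balanced (end_value c) v) <-> boundary c = demand.
Proof.
have E v : balanced (end_value c) v <-> boundary c v = demand v.
  rewrite boundaryE ffunE /balanced /end_value big_split /=.
  split=> h; first by rewrite -h opprD addrA subrr add0r.
  by rewrite -[X in _ + X]opprK -h opprB addrC subrK.
split=> [h|h v]; first by apply/ffunP => v; exact/E.
by apply/E; rewrite h.
Qed.

Lemma circulationP (C : interior_fun G) : circulation_function C <->
  exists2 c, boundary c = demand & C = circulation_of c.
Proof.
split=> [circ|[c cd ->]]; last exact/circulation_of_balanced/balanced_boundary.
have [Cint _ _] := circ; have /circulation_ofP[c Cc] := Cint.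
exists c => //; apply/balanced_boundary/circulation_of_balanced.
by rewrite -Cc.
Qed.

Lemma sum_demand : \sum_v demand v = - moment (G := G) setT.
Proof.
under eq_bigr do rewrite ffunE.
by rewrite sumrN sum_over_stars moment_setT.
Qed.

Lemma exists_circulation :
  (exists C : interior_fun G, circulation_function C) <->
  (\int[mass G]_p (height p)%:E = 0)%E.
Proof.
rewrite momentE//; split=> [[C /circulationP[c cd _]]|[m0]].
  congr EFin; apply: oppr_inj.
  by rewrite -sum_demand -cd sum_boundary oppr0.
have [|c cd] := @boundary_onto _ _ demand (@graph_connected _ G).
  by rewrite sum_demand m0 oppr0.
by exists (circulation_of c); apply/circulationP; exists c.
Qed.

Definition edgewise_cst c : interior_fun G := fun p => c p.1.

Lemma sum_edgewise_cst n (a : 'I_n -> R) (k : 'I_n -> {ffun edge G -> R^o}) :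
  \sum_i a i *: edgewise_cst (k i) = edgewise_cst (\sum_i a i *: k i).
Proof.
apply/funext => p; rewrite fct_sumE /edgewise_cst sum_ffunE.
by apply: eq_bigr => i _; rewrite !ffunE.
Qed.

(** Two solutions c of the linear system differ by an element of the kernel of
    the boundary map, so a basis of the kernel, read as functions constant on
    each edge, spans the differences of circulation functions. *)
Lemma circulations_affine (C : interior_fun G) : circulation_function C ->
  affine_space_of_dim (betti1 R G)
    [set C : interior_fun G | circulation_function C].
Proof.
move=> /circulationP[c cd _].
pose U := lker (linfun (@boundary R G)).
have memU d : (d \in U) = (boundary d == 0) by rewrite memv_ker lfunE.
exists (circulation_of c).
exists (fun i : 'I_(\dim U) => edgewise_cst (vbasis U)`_i); split.
  move=> a; rewrite sum_edgewise_cst => a0.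
  have /freeP := basis_free (vbasisP U); apply.
  by apply/ffunP => e; rewrite ffunE; have := congr1 (@^~ (e, 0)) a0.
have shift d : circulation_of (c + d) = circulation_of c + edgewise_cst d.
  by apply/funext => p; rewrite /circulation_of /edgewise_cst ffunE addrAC.
apply/seteqP; split=> [_ /circulationP[d dd ->]|_ [a _ <-]] /=.
  have dU : d - c \in U by rewrite memU linearB /= dd cd subrr.
  exists (fun i => coord (vbasis U) i (d - c)) => //.
  by rewrite sum_edgewise_cst -coord_vbasis// -shift addrC subrK.
rewrite sum_edgewise_cst; apply/circulationP; rewrite -shift; eexists; last by [].
rewrite linearD /= cd -[RHS]addr0; congr (_ + _); apply/eqP; rewrite -memU.
by apply: memv_suml => i _; apply/memvZ/vbasis_mem/mem_nth; rewrite size_tuple.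
Qed.

End Circulations.

Theorem proposition4p5 (R : realType) (G : measured_reeb_graph R) :
  ((exists C : interior_fun G, circulation_function C) <->
   (\int[mass G]_p (height p)%:E = 0)%E) /\
  ((exists C : interior_fun G, circulation_function C) ->
   affine_space_of_dim (betti1 R G)
     [set C : interior_fun G | circulation_function C]).
Proof.
split; first exact: exists_circulation.
by case=> C; exact: circulations_affine.
Qed.
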